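(* Let $K$ be any field and let $G$ be a connected simple graph on the vertex set $[n]=\{1,\ldots,n\}$. Suppose that $G$ has exactly one cycle $C$. If $n\geq 4$ and $C$ is odd of length $3$, then $\mathrm{ara}(J_G)=n-1$, where $J_G\subset K[x_1,\ldots,x_{2n}]$ is the binomial edge ideal of $G$.
   Context: The binomial edge ideal $J_G\subset R=K[x_1,\ldots,x_n,x_{n+1},\ldots,x_{2n}]$ of a simple graph $G$ on $[n]$ is the ideal generated by the binomials $f_{ij}=x_ix_{n+j}-x_jx_{n+i}$, $i<j$, with $\{i,j\}$ an edge of $G$. The arithmetical rank $\mathrm{ara}(J)$ of an ideal $J$ is the smallest integer $s$ for which there exist polynomials $F_1,\ldots,F_s\in J$ with $\mathrm{rad}(J)=\mathrm{rad}(F_1,\ldots,F_s)$. *)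

(* Defs.v *)
From HB Require Import structures.
From mathcomp Require Import all_boot all_order all_algebra.
From mathcomp Require Import mpoly.

Set Implicit Arguments.
Unset Strict Implicit.
Unset Printing Implicit Defensive.

Import GRing.Theory.

Local Open Scope ring_scope.

Section Ideals.

Variable R : comNzRingType.
Implicit Types (S I J : R -> Prop) (p : R).

Definition gen_ideal S p : Prop :=
  exists (k : nat) (a g : 'I_k -> R),
    (forall i, S (g i)) /\ p = \sum_i a i * g i.

Definition rad I p : Prop := exists m : nat, I (p ^+ m).

Definition rad_gen_by I (s : nat) : Prop :=
  exists F : 'I_s -> R,
    (forall i, I (F i)) /\
    (forall p, rad I p <-> rad (gen_ideal (fun q => exists i, q = F i)) p).

(* [is_ara I s] says ara(I) = s. It is a relation because the minimum exists
   only when [I] is, up to radical, finitely generated. *)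
Definition is_ara I (s : nat) : Prop :=
  rad_gen_by I s /\ (forall t, rad_gen_by I t -> (s <= t)%N).

End Ideals.

Section Graphs.

Variable V : finType.
Implicit Types (e : rel V) (c : seq V).

Definition simple_graph e : Prop := ssrbool.symmetric e /\ irreflexive e.

Definition connected_graph e : Prop := forall x y, connect e x y.

(* The bound on the size excludes the closed walk x, y, x along an edge, which
   satisfies [ucycle e]. *)
Definition graph_cycle e c : Prop := ucycle e c /\ (3 <= size c)%N.

Definition cycle_edges c : {set {set V}} := [set [set x; next c x] | x in c].

(* A vertex sequence lists a cycle from a chosen starting point in a chosen
   direction. Two sequences list the same cycle, as a subgraph, exactly when
   their edge sets agree, so uniqueness is stated for edge sets. *)
Definition only_cycle e c : Prop :=
  graph_cycle e c /\
  (forall c', graph_cycle e c' -> cycle_edges c' = cycle_edges c).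

End Graphs.

Section BinomialEdgeIdeal.

Variables (K : fieldType) (n : nat).

(* Vertices are numbered from 0: for i : 'I_n, the variable 'X_(lshift n i) is
   the paper's x_(i+1) and 'X_(rshift n i) is its x_(n+i+1). *)
Definition edge_binomial (i j : 'I_n) : {mpoly K[n + n]} :=
  'X_(lshift n i) * 'X_(rshift n j) - 'X_(lshift n j) * 'X_(rshift n i).

Definition binomial_edge_ideal (e : rel 'I_n) : {mpoly K[n + n]} -> Prop :=
  gen_ideal (fun p => exists i j : 'I_n,
    [/\ (i < j)%N, e i j & p = edge_binomial i j]).

End BinomialEdgeIdeal.

(* Main.v *)
(* Upper bound: a connected graph with one cycle has n edges, and, as n >= 4,
   some edge cd joins the triangle abc to a further vertex d. The Pluecker
   relation puts f_ab f_cd in the ideal of the other binomials, so up to radical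
   the two generators f_ab and f_cd can be replaced by their sum.
   Lower bound: substituting x_i = 1 and y_0 = 0 maps J_G into the maximal ideal
   (z_1, .., z_(n-1)) and onto generators of it. So t polynomials generating J_G
   up to radical give t polynomials generating an ideal primary to the maximal
   ideal of the origin, and comparing the growth in s of the dimension of
   K[z] / (z)^s with the number of power products of the t polynomials of degree
   below s gives n - 1 <= t. *)

Require Import Defs.
From HB Require Import structures.
From mathcomp Require Import all_boot all_order all_algebra.
From mathcomp Require Import ring zify.
From mathcomp Require Import mpoly.

Set Implicit Arguments.
Unset Strict Implicit.
Unset Printing Implicit Defensive.

(* [Defs] again, because mathcomp also exports a [rad]. *)
Import GRing.Theory Defs.

Local Open Scope ring_scope.

(** * Ideals, radicals and generation up to radical *)

Definition is_ideal (R : comNzRingType) (I : R -> Prop) : Prop :=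
  [/\ I 0, forall p q, I p -> I q -> I (p + q) & forall a p, I p -> I (a * p)].

Section IdealTheory.

Variable R : comNzRingType.
Implicit Types (S I : R -> Prop) (p q a : R).

Lemma ideal_sum I (T : finType) (F : T -> R) :
  is_ideal I -> (forall i, I (F i)) -> I (\sum_i F i).
Proof. by case=> I0 ID _ IF; apply: (big_ind I). Qed.

Lemma idealN I p : is_ideal I -> I p -> I (- p).
Proof. by case=> _ _ IM Ip; rewrite -mulN1r; apply: IM. Qed.

Lemma gen_ideal_is_ideal S : is_ideal (gen_ideal S).
Proof.
split=> [|p q [k [a [g [Sg ->]]]] [l [b [h [Sh ->]]]]|a p [k [b [g [Sg ->]]]]].
- by exists 0%N, (fun=> 0), (fun=> 0); split=> [[]//|]; rewrite big_ord0.
- exists (k + l)%N, (fun i => match split i with inl j => a j | inr j => b j end),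
    (fun i => match split i with inl j => g j | inr j => h j end).
  split=> [i|]; first by case: split.
  rewrite big_split_ord /=; congr (_ + _); apply: eq_bigr => i _.
    by have := unsplitK (inl i : 'I_k + 'I_l) => /= ->.
  by have := unsplitK (inr i : 'I_k + 'I_l) => /= ->.
- exists k, (fun i => a * b i), g; split=> //.
  by rewrite mulr_sumr; apply: eq_bigr => i _; rewrite mulrA.
Qed.

Lemma mem_gen_ideal S p : S p -> gen_ideal S p.
Proof.
by move=> Sp; exists 1%N, (fun=> 1), (fun=> p); rewrite big_ord1 mul1r.
Qed.

Lemma gen_ideal_min S I :
  is_ideal I -> (forall p, S p -> I p) -> forall p, gen_ideal S p -> I p.
Proof.
move=> idI SI p [k [a [g [Sg ->]]]]; apply: ideal_sum => // i.
by case: idI => _ _; apply; apply: SI.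
Qed.

(** A sum in [gen_ideal] may use a generator several times; its coefficients are collected into one
    for each index. *)
Lemma gen_ideal_familyP s (F : 'I_s -> R) p :
  gen_ideal (fun q => exists i, q = F i) p ->
  exists c : 'I_s -> R, p = \sum_i c i * F i.
Proof.
move: p; apply: gen_ideal_min => [|p [i ->]]; last first.
  exists (fun j => (j == i)%:R); rewrite (bigD1 i) //= eqxx mul1r big1 ?addr0 //.
  by move=> j /negPf ->; rewrite mul0r.
split=> [|p q [c ->] [d ->]|a p [c ->]].
- by exists (fun=> 0); rewrite big1 // => i; rewrite mul0r.
- exists (fun i => c i + d i); rewrite -big_split.
  by apply: eq_bigr => i _; rewrite mulrDl.
- exists (fun i => a * c i); rewrite mulr_sumr.
  by apply: eq_bigr => i _; rewrite mulrA.
Qed.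

Lemma rad_is_ideal I : is_ideal I -> is_ideal (rad I).
Proof.
move=> idI; case: (idI) => I0 _ IM.
split=> [|p q [m Ip] [l Iq]|a p [m Ip]]; first by exists 1%N; rewrite expr0n.
  exists (m + l)%N; rewrite exprDn; apply: ideal_sum => // i.
  rewrite -mulr_natl; apply: (IM).
  (* In each binomial term either [q] has exponent at least [l] or [p] has exponent at least [m]. *)
  case: (leqP l i) => [/subnK <-|lt_il].
    by rewrite exprD mulrA; apply: IM.
  have /subnK <- : (m <= m + l - i)%N by lia.
  by rewrite exprD -mulrA; apply: (IM); rewrite mulrC; apply: IM.
by exists m; rewrite exprMn; apply: IM.
Qed.

Lemma rad_idem I p : rad (rad I) p -> rad I p.
Proof. by case=> m [l Ip]; exists (m * l)%N; rewrite exprM. Qed.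

Lemma rad_mono I J : (forall p, I p -> J p) -> forall p, rad I p -> rad J p.
Proof. by move=> IJ p [m /IJ]; exists m. Qed.

Lemma sub_rad I p : I p -> rad I p.
Proof. by exists 1%N. Qed.

(* [g ^ 2 = g (g + h) - g h], and [h ^ 2] likewise. *)
Lemma rad_of_sum_of_mul I g h :
  is_ideal I -> I (g + h) -> I (g * h) -> rad I g /\ rad I h.
Proof.
move=> idI; case: (idI) => _ ID IM Is Ip.
split; exists 2%N.
  have -> : g ^+ 2 = g * (g + h) + - (g * h) by ring.
  by apply: ID; [apply: IM | apply: idealN].
have -> : h ^+ 2 = h * (g + h) + - (g * h) by ring.
by apply: ID; [apply: IM | apply: idealN].
Qed.

(** A list shorter than [s] is padded by the default 0 of [nth]. Testing against every ideal that
    contains the list avoids handling the indexed family in applications. *)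
Lemma rad_gen_by_seq S (gs : seq R) s :
    (size gs <= s)%N -> {in gs, forall g, gen_ideal S g} ->
    (forall I, is_ideal I -> {in gs, forall g, I g} ->
       forall p, S p -> rad I p) ->
  rad_gen_by (gen_ideal S) s.
Proof.
move=> le_gs Sgs gsS; exists (fun i => gs`_i); split=> [i|p].
  case: (ltnP i (size gs)) => [lt_i|ge_i]; first by apply: Sgs; apply: mem_nth.
  by rewrite nth_default //; case: (gen_ideal_is_ideal S).
split.
  move=> rSp; apply: rad_idem; move: p rSp; apply: rad_mono.
  apply: gen_ideal_min; first exact: rad_is_ideal (gen_ideal_is_ideal _).
  apply: gsS; first exact: gen_ideal_is_ideal.
  move=> g /(nthP 0) [i lt_i <-]; apply: mem_gen_ideal.
  by exists (Ordinal (leq_trans lt_i le_gs)).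
move: p; apply: rad_mono; apply: gen_ideal_min => [|q [i ->]].
  exact: gen_ideal_is_ideal.
case: (ltnP i (size gs)) => [lt_i|ge_i]; first by apply: Sgs; apply: mem_nth.
by rewrite nth_default //; case: (gen_ideal_is_ideal S).
Qed.

End IdealTheory.

Lemma preim_is_ideal (A B : comNzRingType) (phi : {rmorphism A -> B}) (I : B -> Prop) :
  is_ideal I -> is_ideal (fun p => I (phi p)).
Proof.
by case=> I0 ID IM; split=> [|p q Ip Iq|a p Ip];
  rewrite ?rmorph0 ?rmorphD ?rmorphM //; [apply: ID | apply: IM].
Qed.

(** * Counting the edges of a connected graph with one cycle *)

Section UnicyclicGraph.

Variables (V : finType) (e : rel V).
Hypotheses (e_simple : simple_graph e) (e_conn : connected_graph e).

Definition edge_sets : {set {set V}} :=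
  [set [set p.1; p.2] | p in [set p | e p.1 p.2]].

(** [d] is the length of a shortest walk from [r]; dropping the last step of such a walk gives a
    neighbour closer to [r]. *)
Lemma exists_parent (r : V) : exists (par : V -> V) (d : V -> nat),
  forall x, x != r -> e (par x) x /\ (d (par x) < d x)%N.
Proof.
pose P x k := [exists p : k.-tuple V, path e r p && (last r p == x)].
have exP x : exists k, P x k.
  have /connectP [p ep ->] := e_conn r x.
  by exists (size p); apply/existsP; exists (in_tuple p); rewrite ep eqxx.
pose d x := ex_minn (exP x).
exists (fun x => odflt r [pick y | e y x && (d y < d x)%N]), d => x ne_xr.
suff [y ed] : exists y, e y x && (d y < d x)%N.
  by case: pickP => [z /andP [] //|/(_ y)]; rewrite /= ed.
have [p sz_p [ep p_last]] : exists2 p, size p = d x & path e r p /\ last r p = x.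
  rewrite /d; case: ex_minnP => k /existsP [p /andP [ep /eqP p_last]] _.
  by exists p; rewrite ?size_tuple.
case/lastP: p sz_p ep p_last => [|p z] sz_p ep p_last.
  by rewrite -p_last eqxx in ne_xr.
rewrite last_rcons in p_last; subst z.
move: sz_p ep; rewrite size_rcons rcons_path => sz_p /andP [ep ex].
exists (last r p); rewrite ex -sz_p /= ltnS /d; case: ex_minnP => m _.
by apply; apply/existsP; exists (in_tuple p); rewrite ep eqxx.
Qed.

(** The tree edges join each [x != r] to its parent, and following parents lowers [d] until [r] is
    reached. *)
Lemma spanning_tree (r : V) : exists TE : {set {set V}},
  (#|TE| < #|V|)%N /\
  forall x y, connect (fun x y => ([set x; y] \in TE) && e x y) x y.
Proof.
have [par [d parP]] := exists_parent r.
have [e_sym _] := e_simple.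
pose TE := [set [set x; par x] | x in [set~ r]].
exists TE; split.
  apply: leq_ltn_trans (leq_imset_card _ _) _.
  by rewrite cardsC1 prednK //; apply/card_gt0P; exists r.
pose T : rel V := fun x y => ([set x; y] \in TE) && e x y.
have T_sym : ssrbool.symmetric T by move=> x y; rewrite /T setUC e_sym.
have Tr x : connect T x r.
  have [k] := ubnP (d x); elim: k x => // k IH x lt_d.
  have [->|ne_xr] := eqVneq x r; first exact: connect0.
  have [e_par lt_par] := parP _ ne_xr.
  apply: connect_trans (IH (par x) (leq_trans lt_par lt_d)).
  apply: connect1; rewrite /T e_sym e_par andbT.
  by apply: imset_f; rewrite !inE.
move=> x y; apply: connect_trans (Tr x) _.
by rewrite (sym_connect_sym T_sym).
Qed.

(** An edge outside a spanning tree closes a cycle with a tree path. This cycle has the edges of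
    [C], so all other edges of [C] are in the tree, and any two edges outside the tree coincide. *)
Lemma unicyclic_card_edges (C : seq V) :
  only_cycle e C -> (#|edge_sets| <= #|V|)%N.
Proof.
case=> [[_ sz_C] uniqC].
case: C sz_C uniqC => [//|r C0] _; move: (r :: C0) => C uniqC.
have [TE [lt_TE T_conn]] := spanning_tree r.
pose T : rel V := fun x y => ([set x; y] \in TE) && e x y.
have [e_sym e_irr] := e_simple.
have cycleP u v : e u v -> [set u; v] \notin TE ->
    [set u; v] \in cycle_edges C /\
    {in cycle_edges C, forall s, s = [set u; v] \/ s \in TE}.
  move=> e_uv uvTE.
  have /connectP [p0 Tp0 v_last] := T_conn u v.
  case/shortenP: Tp0 v_last => p Tp uniq_p _ v_last {p0}.
  have e_p : path e u p by apply: sub_path Tp => x y /andP [].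
  have cyc : graph_cycle e (u :: p).
    split.
      by rewrite /ucycle uniq_p andbT /= rcons_path e_p -v_last e_sym.
    (* The path has at least two edges: with none, [u] would equal [v]; with one, the edge would be
       in [TE]. *)
    case: p {uniq_p e_p} Tp v_last => [|w [|w' p]] //=.
      by move=> _ vu; rewrite vu e_irr in e_uv.
    by move=> /andP [/andP [uw _] _] vw; rewrite vw uw in uvTE.
  rewrite -(uniqC _ cyc); split.
    (* [v] is last on the cycle, and the default of [nth] makes [u] its successor. *)
    apply/imsetP; exists v; first by rewrite v_last mem_last.
    rewrite setUC; congr [set _; _].
    by rewrite next_nth v_last mem_last index_last // nth_default.
  pose T' : rel V := fun x y => ([set x; y] == [set u; v]) || T x y.
  move=> s /imsetP [x x_c ->].
  have /next_cycle/(_ x_c) : cycle T' (u :: p).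
    rewrite /= rcons_path -v_last /T' setUC eqxx andbT.
    by apply: sub_path Tp => y z yz; rewrite /T yz orbT.
  by case/orP=> [/eqP|/andP [? _]]; [left | right].
rewrite -(setID edge_sets TE); apply: leq_trans (leq_card_setU _ _) _.
have le1 : (#|edge_sets :\: TE| <= 1)%N.
  apply/card_le1_eqP => s t /setDP [/imsetP [[u v] e_uv ->] /= gT].
  move=> /setDP [/imsetP [[u' v'] e_uv' ->] /= hT].
  rewrite !inE /= in e_uv e_uv'.
  have [g_C _] := cycleP _ _ e_uv gT.
  have [_ /(_ _ g_C)] := cycleP _ _ e_uv' hT.
  by case=> // gTE; rewrite gTE in gT.
have := subset_leq_card (subsetIr edge_sets TE); lia.
Qed.

End UnicyclicGraph.

(** Otherwise [C] is closed under adjacency and contains every vertex. The endpoint [d] may have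
    further neighbours. *)
Lemma exists_pendant_edge (V : finType) (e : rel V) (C : seq V) :
    ssrbool.symmetric e -> connected_graph e -> C != [::] ->
    (size C < #|V|)%N ->
  exists2 z, z \in C & exists2 d, d \notin C & e z d.
Proof.
move=> e_sym e_conn; case: C => // a C0 _; move: (a :: C0) (mem_head a C0).
move=> C aC lt_C.
have [|no] := boolP [exists z in C, [exists d, (d \notin C) && e z d]].
  by case/exists_inP=> z zC /existsP [d /andP [dC ezd]]; exists z => //; exists d.
have clC : closed e C.
  apply: intro_closed => [|x y e_xy xC]; first exact: sym_connect_sym.
  apply: contraNT no => yC; apply/exists_inP; exists x => //.
  by apply/existsP; exists y; rewrite yC.
have : (#|V| <= #|C|)%N.
  apply: subset_leq_card; apply/subsetP => x _.
  by rewrite -(closed_connect clC (e_conn a x)).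
by have := card_size C; lia.
Qed.

(** * Upper bound: one generator fewer than edges, up to radical *)

Section UpperBound.

Variables (K : fieldType) (n : nat) (e : rel 'I_n).
Hypothesis e_simple : simple_graph e.

Local Notation f := (@edge_binomial K n).
Local Notation J := (@binomial_edge_ideal K n e).

Lemma edge_binomialC (i j : 'I_n) : f j i = - f i j.
Proof. by rewrite /edge_binomial; ring. Qed.

Lemma edge_binomial_in (i j : 'I_n) : e i j -> J (f i j).
Proof.
have [e_sym e_irr] := e_simple => e_ij.
case: (ltngtP i j) => [lt_ij|lt_ji|/val_inj ij]; last by rewrite ij e_irr in e_ij.
  by apply: mem_gen_ideal; exists i, j.
rewrite edge_binomialC; apply: idealN; first exact: gen_ideal_is_ideal.
by apply: mem_gen_ideal; exists j, i; rewrite e_sym.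
Qed.

Definition edge_pairs : {set 'I_n * 'I_n} :=
  [set p : 'I_n * 'I_n | (p.1 < p.2)%N && e p.1 p.2].

Lemma card_edge_pairs : (#|edge_pairs| <= #|edge_sets e|)%N.
Proof.
rewrite -(@card_in_imset _ _ (fun p : 'I_n * 'I_n => [set p.1; p.2])).
  apply: subset_leq_card; apply: imsetS; apply/subsetP => p.
  by rewrite !inE => /andP [].
move=> [i j] [k l]; rewrite !inE /= => /andP [lt_ij _] /andP [lt_kl _] /setP E.
have := E i; have := E j; rewrite !inE !eqxx orbT /=.
move=> /esym/orP [] /eqP jE /esym/orP [] /eqP iE; move: lt_ij lt_kl;
  by rewrite jE iE // ?ltnn // => /ltnW; rewrite leqNgt => /negP.
Qed.

Definition sort_pair (i j : 'I_n) := if (i < j)%N then (i, j) else (j, i).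

Lemma sort_pair_edge i j : e i j -> sort_pair i j \in edge_pairs.
Proof.
have [e_sym e_irr] := e_simple => e_ij; rewrite inE /sort_pair.
case: (ltngtP i j) => [lt_ij|lt_ji|/val_inj ij]; last by rewrite ij e_irr in e_ij.
  by rewrite lt_ij.
by rewrite lt_ji e_sym.
Qed.

Lemma sort_pair_id (i j : 'I_n) : (i < j)%N -> sort_pair i j = (i, j).
Proof. by rewrite /sort_pair => ->. Qed.

(** Used to tell two edges apart by an endpoint of one that is missing from the other. *)
Lemma sort_pair_inj i j k l :
  sort_pair i j = sort_pair k l -> (i == k) || (i == l).
Proof.
by rewrite /sort_pair; do 2!case: ifP => _; case=> *; subst; rewrite eqxx ?orbT.
Qed.

Lemma sort_pairC i j : sort_pair i j = sort_pair j i.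
Proof. by rewrite /sort_pair; case: ltngtP => // /val_inj ->. Qed.

(* The Pluecker relation [f_ab f_cd = f_ac f_bd - f_ad f_bc] puts [f_ab f_cd]
   in the ideal of the remaining edges, so [f_ab] and [f_cd] can be replaced by
   their sum. *)
Lemma rad_gen_by_pendant_triangle a b c d s :
    [/\ e a b, e b c & e a c] -> e c d -> d \notin [:: a; b; c] ->
    (#|edge_pairs| <= s.+1)%N ->
  rad_gen_by J s.
Proof.
move=> [e_ab e_bc e_ac] e_cd d_abc le_s; have [e_sym e_irr] := e_simple.
have neq i j : e i j -> i != j by apply: contraTneq => ->; rewrite e_irr.
move: (neq _ _ e_ab) (neq _ _ e_bc) (neq _ _ e_ac) (neq _ _ e_cd).
move=> ne_ab ne_bc ne_ac ne_cd.
move: d_abc; rewrite !inE !negb_or => /and3P [ne_da ne_db _].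
pose P := edge_pairs :\ sort_pair a b :\ sort_pair c d.
(* Two binomials give way to one sum, so [gs] is one shorter than the number of edges. *)
pose gs := f a b + f c d :: [seq f p.1 p.2 | p <- enum P].
have ne_sort : sort_pair c d != sort_pair a b.
  apply/eqP => /sort_pair_inj.
  by rewrite ![c == _]eq_sym (negPf ne_ac) (negPf ne_bc).
apply: (@rad_gen_by_seq _ _ gs).
- rewrite /= size_map -cardE.
  have := cardsD1 (sort_pair a b) edge_pairs.
  have := cardsD1 (sort_pair c d) (edge_pairs :\ sort_pair a b).
  rewrite -/P in_setD1 ne_sort !sort_pair_edge //= => ->.
  by move=> cardE; rewrite cardE in le_s.
- have [_ JD _] := gen_ideal_is_ideal (fun p => exists i j : 'I_n,
    [/\ (i < j)%N, e i j & p = f i j]).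
  move=> g; rewrite inE => /predU1P [->|/mapP [[i j] + ->]].
    by apply: JD; apply: edge_binomial_in.
  by rewrite mem_enum !inE => /and3P [_ _ /andP [_ /edge_binomial_in]].
move=> I idI gsI p [i [j [lt_ij e_ij ->]]]; have [_ ID IM] := idI.
have other k l : e k l -> sort_pair k l != sort_pair a b ->
    sort_pair k l != sort_pair c d -> I (f k l).
  move=> e_kl kl_ab kl_cd.
  suff: I (f (sort_pair k l).1 (sort_pair k l).2).
    rewrite /sort_pair; case: ifP => // _ Ilk.
    by rewrite edge_binomialC; apply: idealN.
  apply: gsI; rewrite inE; apply/orP; right; apply/mapP.
  by exists (sort_pair k l); rewrite // mem_enum !in_setD1 kl_ab kl_cd sort_pair_edge.
have neg_sort k l k' l' : k != k' -> k != l' -> sort_pair k l != sort_pair k' l'.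
  move=> kk' kl'; apply/eqP => /sort_pair_inj.
  by rewrite (negPf kk') (negPf kl').
have I_ac : I (f a c).
  apply: other => //; first by rewrite sort_pairC neg_sort // eq_sym.
  by rewrite neg_sort // eq_sym.
have I_bc : I (f b c).
  apply: other => //; first by rewrite sort_pairC neg_sort // eq_sym.
  by rewrite neg_sort // eq_sym.
have [rad_ab rad_cd] : rad I (f a b) /\ rad I (f c d).
  apply: rad_of_sum_of_mul => //; first by apply: gsI; rewrite inE eqxx.
  (* [f a c] and [f b c] come from the triangle and lie in [I]; [f b d] and [f a d] are mere
     coefficients, whether or not these pairs are edges. *)
  have -> : f a b * f c d = f b d * f a c + - f a d * f b c.
    by rewrite /edge_binomial; ring.
  by apply: ID; apply: IM.
have radP k l : rad I (f k l) -> rad I (f (sort_pair k l).1 (sort_pair k l).2).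
  rewrite /sort_pair; case: ifP => // _ Ikl.
  by rewrite edge_binomialC; apply: idealN => //; apply: rad_is_ideal.
have [ab|ne_ijab] := eqVneq (sort_pair i j) (sort_pair a b).
  by have := radP _ _ rad_ab; rewrite -ab sort_pair_id.
have [cd|ne_ijcd] := eqVneq (sort_pair i j) (sort_pair c d).
  by have := radP _ _ rad_cd; rewrite -cd sort_pair_id.
by apply: sub_rad; apply: other.
Qed.

Lemma rad_gen_by_unicyclic_triangle C :
    connected_graph e -> only_cycle e C -> size C = 3 -> (4 <= n)%N ->
  rad_gen_by J n.-1.
Proof.
move=> e_conn uniC sz_C n4; have [[ucC _] _] := uniC.
have [e_sym _] := e_simple.
have le_n : (#|edge_pairs| <= n.-1.+1)%N.
  apply: leq_trans card_edge_pairs _.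
  have := unicyclic_card_edges e_simple e_conn uniC; rewrite card_ord; lia.
have [||z zC [d dC e_zd]] := exists_pendant_edge e_sym e_conn (C := C).
- by case: C sz_C {uniC ucC}.
- by rewrite card_ord sz_C.
case: C sz_C {uniC} ucC zC dC => [|a [|b [|c []]]] //= _.
case/andP=> /= /and4P [e_ab e_bc e_ca _] _.
move=> zC; rewrite !inE !negb_or => /and3P [da db dc].
(* The triangle is rotated so that the vertex joined to [d] takes the role of [c]. *)
move: zC; rewrite !inE => /or3P [] /eqP zE; rewrite zE in e_zd;
  [apply: (@rad_gen_by_pendant_triangle b c a d)
  |apply: (@rad_gen_by_pendant_triangle c a b d)
  |apply: (@rad_gen_by_pendant_triangle a b c d)] => //;
  rewrite ?inE ?negb_or ?da ?db ?dc //; split=> //; by rewrite e_sym.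
Qed.

End UpperBound.

(** * Order of vanishing at the origin and the dimension count *)

Section OrderFiltration.

Variables (K : fieldType) (m : nat).
Implicit Types (p q : {mpoly K[m]}).

(** Membership in the [s]-th power of the ideal generated by the variables, read off the
    coefficients. *)
Definition ord_ge s p : Prop := forall mu : 'X_{1..m}, (mdeg mu < s)%N -> p@_mu = 0.

Lemma ord_geM s t p q : ord_ge s p -> ord_ge t q -> ord_ge (s + t) (p * q).
Proof.
move=> ps qt mu lt_mu; rewrite mcoeffM big1 // => k /eqP muE.
case: (ltnP (mdeg k.1) s) => [/ps ->|ge_s]; first by rewrite mul0r.
rewrite qt ?mulr0 //; have := congr1 mdeg muE; rewrite mdegD.
by move: lt_mu ge_s; move: (mdeg mu) (mdeg k.1) (mdeg k.2); lia.
Qed.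

Lemma ord_ge_is_ideal s : is_ideal (ord_ge s).
Proof.
split=> [mu _|p q ps qs mu lt_mu|a p ps]; first exact: mcoeff0.
  by rewrite mcoeffD ps ?qs ?addr0.
by rewrite -[s]add0n; apply: ord_geM.
Qed.

(** [mmap1 F al] is the product of the powers [F i ^+ al i], so the orders add up. *)
Lemma ord_ge_mmap1 t (F : 'I_t -> {mpoly K[m]}) (al : 'X_{1..t}) :
  (forall i, ord_ge 1 (F i)) -> ord_ge (mdeg al) (mmap1 F al).
Proof.
move=> F1; rewrite mdegE /mmap1.
apply: (big_ind2 (fun q k => ord_ge k q)) => // [q k q' k'|i _].
  exact: ord_geM.
elim: (al i) => // k IH; rewrite exprS -addn1 addnC.
exact: ord_geM.
Qed.

Lemma ord_geB_low D p :
  ord_ge D (p - \sum_(mu : 'X_{1..m < D}) p@_mu *: 'X_[mu]).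
Proof. by move=> mu lt_mu; rewrite mcoeffB (mcoeff_mpoly (fun nu => p@_nu)) // subrr. Qed.

Section Span.

Variables (t D s : nat) (F : 'I_t -> {mpoly K[m]}).
Hypotheses (F1 : forall i, ord_ge 1 (F i))
  (FD : forall p, ord_ge D p -> gen_ideal (fun q => exists i, q = F i) p).

Local Notation Q := ('X_{1..t < s} * 'X_{1..m < D})%type.

(** A congruence modulo order [s]. As [Q] is finite, its cardinality bounds the dimension of the
    quotient once every [p] is spanned. *)
Definition spanned p : Prop := exists c : Q -> K,
  ord_ge s (p - \sum_q c q *: ('X_[q.2] * mmap1 F q.1)).

Lemma spanned_ord_ge p : ord_ge s p -> spanned p.
Proof.
by move=> ps; exists (fun=> 0); rewrite big1 ?subr0 // => q _; rewrite scale0r.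
Qed.

Lemma spannedD p q : spanned p -> spanned q -> spanned (p + q).
Proof.
move=> [c cp] [d dq]; exists (fun i => c i + d i).
have -> : \sum_i (c i + d i) *: ('X_[i.2] * mmap1 F i.1) =
    \sum_i c i *: ('X_[i.2] * mmap1 F i.1) + \sum_i d i *: ('X_[i.2] * mmap1 F i.1).
  by rewrite -big_split; apply: eq_bigr => i _; rewrite scalerDl.
by rewrite opprD addrACA; case: (ord_ge_is_ideal s) => _ ID _; apply: ID.
Qed.

Lemma spannedZ a p : spanned p -> spanned (a *: p).
Proof.
move=> [c cp]; exists (fun i => a * c i).
have -> : \sum_i (a * c i) *: ('X_[i.2] * mmap1 F i.1) =
    a *: \sum_i c i *: ('X_[i.2] * mmap1 F i.1).
  by rewrite scaler_sumr; apply: eq_bigr => i _; rewrite scalerA.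
by rewrite -scalerBr => mu lt_mu; rewrite mcoeffZ cp ?mulr0.
Qed.

Lemma spanned_sum (T : finType) (p : T -> {mpoly K[m]}) :
  (forall i, spanned (p i)) -> spanned (\sum_i p i).
Proof.
move=> sp; apply: (big_ind spanned) => // [|p1 p2]; last exact: spannedD.
by apply: spanned_ord_ge => mu _; apply: mcoeff0.
Qed.

Lemma spanned_gen (i : Q) : spanned ('X_[i.2] * mmap1 F i.1).
Proof.
exists (fun j => (j == i)%:R).
rewrite (bigD1 i) //= eqxx scale1r big1 => [|j /negPf ->]; last exact: scale0r.
by rewrite addr0 subrr => mu _; apply: mcoeff0.
Qed.

(* Expand the part of [p] of order at least [D] along [F] and recurse on the
   order of the power product of the [F i]. *)
Lemma spanned_mul_mmap1 k p (al : 'X_{1..t}) :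
  (s <= mdeg al + k)%N -> spanned (p * mmap1 F al).
Proof.
elim: k p al => [|k IH] p al le_s.
  apply: spanned_ord_ge; rewrite addn0 in le_s => mu lt_mu.
  have [_ _ IM] := ord_ge_is_ideal (mdeg al).
  by apply: (IM p _ (ord_ge_mmap1 (al := al) F1) mu); apply: leq_trans lt_mu le_s.
have [le_al|lt_al] := leqP s (mdeg al).
  by apply: (IH); lia.
rewrite -[p](subrK (\sum_(mu : 'X_{1..m < D}) p@_mu *: 'X_[mu])) mulrDl.
apply: spannedD; last first.
  rewrite mulr_suml; apply: spanned_sum => mu; rewrite -scalerAl.
  by apply: spannedZ; apply: (spanned_gen (BMultinom lt_al, mu)).
have /FD/gen_ideal_familyP [c ->] := ord_geB_low (D := D) p.
rewrite mulr_suml; apply: spanned_sum => i.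
have -> : c i * F i * mmap1 F al = c i * mmap1 F (U_(i) + al).
  by rewrite commr_mmap1_M ?mmap1U ?mulrA // => *; apply: mulrC.
by apply: IH; rewrite mdegD mdeg1; lia.
Qed.

Lemma spanned_all p : spanned p.
Proof.
rewrite -[p]mulr1 -(mmap11 F); apply: (spanned_mul_mmap1 (k := s)).
by rewrite mdeg0.
Qed.

End Span.

(** Each exponent is at most the degree, hence below [s]. This crude bound has the right growth in
    [s]. *)
Lemma card_bmultinom t s : (0 < s)%N -> (#|{: 'X_{1..t < s}}| <= s ^ t)%N.
Proof.
case: s => // s _.
rewrite -[X in (X ^ _)%N](card_ord s.+1) -[X in (_ ^ X)%N](card_ord t) -card_ffun.
pose g (al : 'X_{1..t < s.+1}) : {ffun 'I_t -> 'I_s.+1} := [ffun i => inord (al i)].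
apply: (@leq_card _ _ g) => al be /ffunP g_eq; apply/val_inj/mnmP => i.
have lt_s (ga : 'X_{1..t < s.+1}) : (ga i < s.+1)%N.
  apply: leq_ltn_trans (bmdeg ga).
  by rewrite mdegE (bigD1 i) //= leq_addr.
by have := g_eq i; rewrite !ffunE => /(congr1 val); rewrite /= !inordK.
Qed.

(* If [t < m], the [r ^ m] monomials with exponents below [r] are independent
   modulo order [m r], but that quotient is spanned by at most
   [(m r) ^ t * #|'X_{1..m < D}|] elements. *)
Lemma leq_of_primary t D (F : 'I_t -> {mpoly K[m]}) :
    (forall i, ord_ge 1 (F i)) ->
    (forall p, ord_ge D p -> gen_ideal (fun q => exists i, q = F i) p) ->
  (m <= t)%N.
Proof.
move=> F1 FD; rewrite leqNgt; apply/negP => lt_tm.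
(* The choice [r > m ^ t * C] gives [(m * r) ^ t * C < r ^ t.+1 <= r ^ m]. *)
pose C := #|{: 'X_{1..m < D}}|; pose r := (m ^ t * C).+1.
pose s := (m * r)%N; have m_gt0 : (0 < m)%N by apply: leq_ltn_trans lt_tm.
have s_gt0 : (0 < s)%N by rewrite muln_gt0 m_gt0.
pose P := {ffun 'I_m -> 'I_r}; pose Q := ('X_{1..t < s} * 'X_{1..m < D})%type.
have lt_QP : (#|{: Q}| < #|{: P}|)%N.
  rewrite card_prod card_ffun !card_ord.
  apply: leq_ltn_trans (leq_mul (card_bmultinom t s_gt0) (leqnn C)) _.
  apply: (@leq_trans (r ^ t.+1)%N); last by rewrite leq_pexp2l.
  rewrite /s expnMn mulnAC expnS ltn_pmul2r ?expn_gt0 //.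
pose mon (f : P) : 'X_{1..m} := [multinom (f i : nat) | i < m].
have [c cP] := @fin_all_exists P _ _ (fun f => spanned_all s F1 FD 'X_[mon f]).
pose M := \matrix_(i < #|{: P}|, j < #|{: Q}|) c (enum_val i) (enum_val j).
have : kermx M != 0.
  rewrite kermx_eq0 /row_free neq_ltn; apply/orP; left.
  exact: leq_ltn_trans (rank_leq_col M) lt_QP.
case/rowV0Pn => v /sub_kermxP vM /eqP; apply; apply/rowP => i0.
have mon_lt f : (mdeg (mon f) < s)%N.
  rewrite mdegE /s; apply: (@leq_ltn_trans (\sum_(i < m) r.-1)%N).
    by apply: leq_sum => i _; rewrite mnmE /= -ltnS.
  by rewrite sum_nat_const card_ord ltn_pmul2l.
(* The relation [v] cancels the spanning elements, so only remainders of order at least [s] are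
   left. *)
have ord_v : ord_ge s (\sum_i v 0 i *: 'X_[mon (enum_val i)]).
  have -> : \sum_i v 0 i *: 'X_[mon (enum_val i)] = \sum_i v 0 i *:
     ('X_[mon (enum_val i)] - \sum_q c (enum_val i) q *: ('X_[q.2] * mmap1 F q.1)).
    under [RHS]eq_bigr do rewrite scalerBr.
    rewrite sumrB [X in _ - X](_ : _ = 0) ?subr0 //.
    under eq_bigr do rewrite scaler_sumr.
    rewrite exchange_big big1 // => q _ /=.
    under eq_bigr do rewrite scalerA.
    rewrite -scaler_suml.
    have := congr1 (fun u : 'rV_#|{: Q}| => u 0 (enum_rank q)) vM.
    rewrite !mxE; under eq_bigr do rewrite mxE enum_rankK.
    by move=> ->; rewrite scale0r.
  apply: (ideal_sum (ord_ge_is_ideal s)) => i.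
  by move=> mu lt_mu; rewrite mcoeffZ cP ?mulr0.
(* The monomials are distinct and of degree below [s], so the coefficients [v] must vanish. *)
have := ord_v _ (mon_lt (enum_val i0)).
rewrite raddf_sum (bigD1 i0) //= mcoeffZ mcoeffX eqxx mulr1 big1 ?addr0 ?mxE //.
move=> i ne_i; rewrite mcoeffZ mcoeffX (_ : _ == _ = false) ?mulr0 //.
apply: contraNF ne_i => /eqP/mnmP mon_eq; apply/eqP/enum_val_inj/ffunP => j.
by apply/val_inj; have := mon_eq j; rewrite !mnmE.
Qed.

(** Pigeonhole: a monomial of degree above [\sum_i N i] is divisible by some ['X_i ^+ N i]. *)
Lemma ord_ge_mem_ideal (N : 'I_m -> nat) (I : {mpoly K[m]} -> Prop) p :
    is_ideal I -> (forall i, I ('X_i ^+ N i)) ->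
  ord_ge (\sum_i N i).+1 p -> I p.
Proof.
move=> idI IN pD; have [I0 ID IM] := idI.
rewrite [p]mpolyE big_seq; apply: (big_ind I) => // mu mu_p.
have le_mu : (\sum_i N i < mdeg mu)%N.
  by rewrite ltnNge; apply/negP => /pD p0; rewrite mcoeff_msupp p0 eqxx in mu_p.
have [i le_i] : exists i, (N i <= mu i)%N.
  apply/existsP; apply: contraLR le_mu; rewrite negb_exists -leqNgt => /forallP lt.
  by rewrite mdegE; apply: leq_sum => i _; rewrite ltnW // ltnNge.
rewrite -mul_mpolyC; apply: (IM).
have le_mnm : (U_(i) *+ N i <= mu)%MM.
  apply/mnm_lepP => j; rewrite mulmnE mnm1E.
  by case: eqVneq => [<-|_]; rewrite ?mul1n ?mul0n.
by rewrite -(submK le_mnm) mpolyXD -mpolyXn; apply: IM.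
Qed.

End OrderFiltration.

(** * Lower bound by specialization to [m] variables *)

Section LowerBound.

Variables (K : fieldType) (m : nat) (e : rel 'I_m.+1).
Hypotheses (e_simple : simple_graph e) (e_conn : connected_graph e).

Local Notation f := (@edge_binomial K m.+1).
Local Notation J := (@binomial_edge_ideal K m.+1 e).

(** The edge binomials specialize to differences of values of [y]; the value 0 at [ord0] lets these
    differences generate all the variables. *)
Let y (j : 'I_m.+1) : {mpoly K[m]} := oapp (fun i => 'X_i) 0 (unlift ord0 j).

Let point : (m.+1 + m.+1).-tuple {mpoly K[m]} :=
  [tuple match split i with inl _ => 1 | inr j => y j end | i < m.+1 + m.+1].

Let phi : {rmorphism {mpoly K[m.+1 + m.+1]} -> {mpoly K[m]}} := comp_mpoly point.

Lemma phi_edge_binomial i j : phi (f i j) = y j - y i.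
Proof.
rewrite /edge_binomial rmorphB !rmorphM /= !comp_mpolyXU -!tnth_nth !tnth_mktuple.
have splitl (k : 'I_m.+1) : split (lshift m.+1 k) = inl k := unsplitK (inl k).
have splitr (k : 'I_m.+1) : split (rshift m.+1 k) = inr k := unsplitK (inr k).
by rewrite !splitl !splitr !mul1r.
Qed.

Lemma phi_binomial_edge_ideal_ord_ge p : J p -> ord_ge 1 (phi p).
Proof.
have y1 j : ord_ge 1 (y j).
  move=> mu; rewrite ltnS leqn0 mdeg_eq0 => /eqP ->.
  by rewrite /y; case: unlift => [i|] /=; rewrite ?mcoeff0 // mcoeffX mnm1_eq0.
move: p; apply: gen_ideal_min => [|_ [i [j [_ _ ->]]]].
  exact: preim_is_ideal (ord_ge_is_ideal _ _ _).
have idI := ord_ge_is_ideal K m 1; have [_ ID _] := idI.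
by rewrite phi_edge_binomial; exact: ID (y1 _) (idealN idI (y1 _)).
Qed.

(** The differences telescope along a path from [ord0]; the induction lets the starting vertex
    vary. *)
Lemma exists_phi_eq_X (i : 'I_m) : exists2 q, J q & phi q = 'X_i.
Proof.
have [J0 JD _] := gen_ideal_is_ideal (fun p => exists i j : 'I_m.+1,
    [/\ (i < j)%N, e i j & p = f i j]).
suff [q Jq phi_q] : exists2 q, J q & phi q = y (lift ord0 i) - y ord0.
  by exists q => //; rewrite phi_q /y liftK unlift_none subr0.
have /connectP [p ep ->] := e_conn ord0 (lift ord0 i).
elim: p ord0 ep => [|z p IH] x /= => [_|/andP [exz /IH [q Jq phi_q]]].
  by exists 0; rewrite ?rmorph0 ?subrr.
exists (q + f x z); first by apply: JD => //; apply: edge_binomial_in.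
by rewrite rmorphD phi_q phi_edge_binomial addrA subrK.
Qed.

(** Each variable is the image of an element of [J], so a power of it lies in the ideal of the
    [phi (F i)]. That ideal then contains everything of large order, and the dimension count
    applies. *)
Lemma rad_gen_by_binomial_edge_ideal_geq t : rad_gen_by J t -> (m <= t)%N.
Proof.
move=> [F [JF radF]].
pose G := gen_ideal (fun q => exists i, q = phi (F i)).
have idG : is_ideal G by apply: gen_ideal_is_ideal.
have GX (i : 'I_m) : exists N, G ('X_i ^+ N).
  have [q Jq <-] := exists_phi_eq_X i.
  have [N FN] := (radF q).1 (sub_rad Jq).
  exists N; rewrite -rmorphXn /=; move: (q ^+ N) FN.
  apply: gen_ideal_min => [|_ [j ->]]; first exact: preim_is_ideal idG.
  by apply: mem_gen_ideal; exists j.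
have [N NP] := fin_all_exists GX.
apply: (@leq_of_primary K m t (\sum_i N i).+1 (fun i => phi (F i))) => [i|p].
  exact: phi_binomial_edge_ideal_ord_ge.
exact: ord_ge_mem_ideal.
Qed.

End LowerBound.

Local Close Scope ring_scope.

Theorem theorem3p9 (K : fieldType) (n : nat) (e : rel 'I_n) (C : seq 'I_n)
    (hG : simple_graph e) (hconn : connected_graph e) (hC : only_cycle e C)
    (hn : 4 <= n) (hC3 : size C = 3) :
  is_ara (@binomial_edge_ideal K n e) n.-1.
Proof.
split; first exact: rad_gen_by_unicyclic_triangle hC hC3 hn.
(* With [n] written as [m.+1], [n.-1] is the number of variables after specialization. *)
case: n e C hG hconn hC hn hC3 => // m e C hG hconn _ _ _ t.
exact: rad_gen_by_binomial_edge_ideal_geq.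
Qed.
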